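(* Let $\mathcal{C}$ be a clutter with vertex set $V(\mathcal{C})=\{t_1,\ldots,t_s\}$, $s\geq 1$, let $S=K[t_1,\ldots,t_s]$ be a polynomial ring over a field $K$, and let $I=I(\mathcal{C})\subset S$ be the edge ideal of $\mathcal{C}$. Then $\mathrm{v}(I)=\dim(S/I)$ if and only if $\mathcal{C}$ is well-covered and $\mathcal{F}_\mathcal{C}=\mathcal{A}_\mathcal{C}$.
   Context: A clutter $\mathcal{C}$ is a finite vertex set $V(\mathcal{C})=\{t_1,\ldots,t_s\}$ together with a family $E(\mathcal{C})$ of nonempty subsets of $V(\mathcal{C})$, called edges, none of which is included in another. The edge ideal $I(\mathcal{C})$ is generated by the monomials $t_e=\prod_{t_i\in e}t_i$, $e\in E(\mathcal{C})$. $\dim$ denotes Krull dimension. A set $A\subset V(\mathcal{C})$ is stable if it contains no edge of $\mathcal{C}$; a maximum stable set is a stable set of largest cardinality. $\mathcal{C}$ is well-covered if every maximal (with respect to inclusion) stable set is a maximum stable set. A vertex cover is a set of vertices meeting every edge; it is minimal if minimal with respect to inclusion. For a stable set $A$, $N_\mathcal{C}(A)$ is the set of all vertices $t_i$ such that $\{t_i\}\cup A$ contains an edge of $\mathcal{C}$. $\mathcal{F}_\mathcal{C}$ is the family of all maximal stable sets of $\mathcal{C}$, and $\mathcal{A}_\mathcal{C}$ is the family of all stable sets $A$ of $\mathcal{C}$ such that $N_\mathcal{C}(A)$ is a minimal vertex cover of $\mathcal{C}$. With the standard grading $S=\bigoplus_{d\ge0}S_d$, for a proper squarefree monomial ideal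 $I\subset S$ the v-number is $\mathrm{v}(I)=\min\{d\geq 0\mid \exists f\in S_d\text{ and }\mathfrak{p}\in\mathrm{Ass}(I)\text{ with }(I\colon f)=\mathfrak{p}\}$, where $\mathrm{Ass}(I)$ is the set of associated primes of $S/I$; in particular $\mathrm{v}(I)=0$ if $I$ is prime. *)

(* Defs.v *)
From HB Require Import structures.
From mathcomp Require Import all_boot all_order all_algebra.
From mathcomp Require Import generic_quotient ring_quotient.
From mathcomp Require Import mpoly boolp.

Set Implicit Arguments.
Unset Strict Implicit.
Unset Printing Implicit Defensive.

Import GRing.Theory.
Local Open Scope ring_scope.
Local Open Scope quotient_scope.

(* Ideals are the boolean predicates of ring_quotient; with the classical
   axioms of boolp, [{pred R}] ranges over all subsets of [R], and the
   membership test of an ideal need not be computable. *)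

Section CommutativeAlgebra.
Variable R : comNzRingType.

(* [idealr_closed] contains [1 \notin P], so [P] is a proper ideal. *)
Definition prime_ideal (P : {pred R}) : Prop :=
  idealr_closed P /\ prime_idealr_closed P.

Definition prime_chain (n : nat) (P : 'I_n.+1 -> {pred R}) : Prop :=
  (forall i, prime_ideal (P i)) /\
  (forall i j : 'I_n.+1, (i < j)%N ->
     {subset P i <= P j} /\ ~ {subset P j <= P i}).

Definition is_krull_dim (d : nat) : Prop :=
  (exists P : 'I_d.+1 -> {pred R}, prime_chain P) /\
  (forall (n : nat) (P : 'I_n.+1 -> {pred R}), prime_chain P -> (n <= d)%N).

Definition colon_ideal (I : {pred R}) (f : R) : {pred R} :=
  [pred g | g * f \in I].

(* [p] is the annihilator in [R] of an element of the [R]-module [R / I]. *)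
Definition associated_prime (I : idealr R) (p : {pred R}) : Prop :=
  prime_ideal p /\
  exists x : {ideal_quot I},
    forall a : R, (a \in p) = (\pi_({ideal_quot I}) a * x == 0).

End CommutativeAlgebra.

Section VNumber.
Variables (K : fieldType) (s : nat).
Implicit Type I : idealr {mpoly K[s]}.

Definition v_degree I (d : nat) : Prop :=
  exists (f : {mpoly K[s]}) (p : {pred {mpoly K[s]}}),
    [/\ f \is d.-homog, associated_prime I p & colon_ideal I f =i p].

Definition is_v_number I (d : nat) : Prop :=
  v_degree I d /\ (forall d' : nat, v_degree I d' -> (d <= d')%N).

End VNumber.

Record clutter (s : nat) := Clutter {
  edges : {set {set 'I_s}};
  edges_nonempty : set0 \notin edges;
  edges_antichain : {in edges &, forall e f : {set 'I_s}, e \subset f -> e = f}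
}.

Section Clutter.
Variables (s : nat) (C : clutter s).
Implicit Type A : {set 'I_s}.

Definition stable A : bool := [forall e in edges C, ~~ (e \subset A)].

Definition maximal_stable A : bool := maxset stable A.

Definition maximum_stable A : bool :=
  stable A && [forall B : {set 'I_s}, stable B ==> (#|B| <= #|A|)%N].

Definition well_covered : Prop :=
  forall A, maximal_stable A -> maximum_stable A.

Definition vertex_cover A : bool := [forall e in edges C, e :&: A != set0].

Definition minimal_vertex_cover A : bool := minset vertex_cover A.

Definition nbhd A : {set 'I_s} :=
  [set i | [exists e in edges C, e \subset i |: A]].

Definition family_F : {set {set 'I_s}} := [set A | maximal_stable A].

Definition family_A : {set {set 'I_s}} :=
  [set A | stable A && minimal_vertex_cover (nbhd A)].

End Clutter.

Section EdgeIdeal.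
Variables (K : fieldType) (s : nat) (C : clutter s).

Definition edge_monomial (e : {set 'I_s}) : {mpoly K[s]} := \prod_(i in e) 'X_i.

Definition edge_ideal : {pred {mpoly K[s]}} :=
  fun p => `[< exists c : {set 'I_s} -> {mpoly K[s]},
                 p = \sum_(e in edges C) c e * edge_monomial e >].

Lemma edge_ideal_idealr_closed : idealr_closed edge_ideal.
Proof.
split.
- apply/asboolP; exists (fun=> 0).
  by rewrite big1 // => e _; rewrite mul0r.
- apply/asboolP => -[c /(congr1 (meval (fun=> 0)))].
  rewrite meval1 raddf_sum big1 /= => [/eqP|e eC]; first by rewrite oner_eq0.
  have /set0Pn [i ie] : e != set0.
    by apply: contraTneq eC => ->; exact: edges_nonempty.
  by rewrite /edge_monomial (bigD1 i) //= !mevalM mevalXU mul0r mulr0.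
- move=> a p q /asboolP[c ->] /asboolP[d ->]; apply/asboolP.
  exists (fun e => a * c e + d e).
  rewrite mulr_sumr -big_split /=; apply: eq_bigr => e _.
  by rewrite mulrDl mulrA.
Qed.

HB.instance Definition _ :=
  isIdealr.Build {mpoly K[s]} edge_ideal edge_ideal_idealr_closed.

End EdgeIdeal.

Arguments edge_ideal K {s} C _ : simpl never.

(* Main.v *)
(* The v-number of I = I(C) is the least cardinality of a set in A_C.  For A in
   A_C, (I : t_A) is generated by the variables in N(A).  Conversely, if (I : f)
   is a prime p, any monomial of f outside I has a support in A_C.  The dimension
   of S/I is the largest cardinality b of a stable set: a prime containing I
   contains the variables of some vertex cover W, and a chain of primes above it
   has length at most |~W|.  Since F_C is always contained in A_C, v(I) = b
   forces every set in A_C to be a maximum stable set, and the converse is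
   immediate.

   The bound on chains P_0 < ... < P_n avoids transcendence degrees: pick x_i in
   P_(i+1) but not in P_i; then the N^n products of powers x_i^a with a < N are
   linearly independent modulo P_0, have degree O(N), and are determined modulo
   P_0 by their coefficients on the O(N^|~W|) monomials in the variables outside
   W.  Hence n <= |~W|. *)

Require Import Defs.
From HB Require Import structures.
From mathcomp Require Import all_boot all_order all_algebra.
From mathcomp Require Import generic_quotient ring_quotient.
From mathcomp Require Import mpoly boolp.

Set Implicit Arguments.
Unset Strict Implicit.
Unset Printing Implicit Defensive.

Import GRing.Theory.
Local Open Scope ring_scope.
Local Open Scope quotient_scope.

(** * Ideals and prime ideals as predicates *)

Section Ideals.
Variables (R : comNzRingType) (P : {pred R}).
Hypothesis Pid : idealr_closed P.

Lemma ideal_add u v : u \in P -> v \in P -> u + v \in P.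
Proof. by case: Pid => _ _ PD uP vP; rewrite -[u]mul1r; exact: PD. Qed.

Lemma ideal_mull a u : u \in P -> a * u \in P.
Proof. by case: Pid => P0 _ PD uP; rewrite -[a * u]addr0; exact: PD. Qed.

Lemma ideal_addK u v : v \in P -> u + v \in P -> u \in P.
Proof.
by move=> vP uvP; rewrite -[u](addrK v) -mulN1r ideal_add ?ideal_mull.
Qed.

Lemma ideal_sum (J : eqType) (r : seq J) (F : J -> R) :
  {in r, forall j, F j \in P} -> \sum_(j <- r) F j \in P.
Proof.
move=> FP; rewrite big_seq; elim/big_ind: _ => //; first by case: Pid.
exact: ideal_add.
Qed.

Lemma prime_ideal_prod (J : finType) (A : {pred J}) (F : J -> R) :
  prime_idealr_closed P -> \prod_(j in A) F j \in P ->
  exists2 j, j \in A & F j \in P.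
Proof.
move=> Ppr; apply: contraPP => noF.
elim/big_rec: _ => [|j x jA xP]; first by apply/negP; case: Pid.
by move/Ppr/orP=> [FjP|//]; apply: noF; exists j.
Qed.

End Ideals.

(** * Primes of [R / I] versus primes of [R] containing [I] *)

Section QuotientIdeals.
Variables (R : comNzRingType) (I : idealr R).
Local Notation Q := {ideal_quot I}.

Lemma ideal_quot_pi_eq0 (a : R) : (\pi_Q a == 0) = (a \in I).
Proof. by rewrite -(rmorph0 (\pi_Q)) -Quotient.idealrBE subr0. Qed.

Lemma prime_ideal_preim (P : {pred Q}) :
  prime_ideal P -> prime_ideal [pred a | \pi_Q a \in P].
Proof.
move=> [[P0 P1 PD] Ppr]; split; first split.
- by rewrite inE rmorph0.
- by rewrite inE rmorph1.
- by move=> a u v; rewrite !inE rmorphD rmorphM; exact: PD.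
- by move=> u v; rewrite !inE rmorphM; exact: Ppr.
Qed.

(** Two representatives of a class differ by an element of [I], hence of [P]. This lets a prime of
    the quotient be encoded by testing [repr]. *)
Lemma mem_repr_pi (P : {pred R}) a :
  idealr_closed P -> {subset I <= P} -> (repr (\pi_Q a) \in P) = (a \in P).
Proof.
move=> Pid IP.
have e (b c : R) : \pi_Q b = \pi_Q c -> b \in P -> c \in P.
  move=> /eqP; rewrite eq_sym -Quotient.idealrBE => /IP cbP bP.
  by rewrite -(subrK b c) ideal_add.
by apply/idP/idP; apply: e; rewrite reprK.
Qed.

Lemma prime_ideal_quot (P : {pred R}) :
  prime_ideal P -> {subset I <= P} -> prime_ideal [pred x : Q | repr x \in P].
Proof.
move=> [Pid Ppr] IP; have reprP := mem_repr_pi _ Pid IP.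
have [P0 P1 PD] := Pid; split; first split.
- by rewrite inE -(rmorph0 (\pi_Q)) reprP.
- by rewrite inE -(rmorph1 (\pi_Q)) reprP.
- move=> a u v; rewrite !inE -[a]reprK -[u]reprK -[v]reprK -rmorphM -rmorphD.
  by rewrite !reprP; exact: PD.
- move=> u v; rewrite !inE -{1}[u]reprK -{1}[v]reprK -rmorphM reprP.
  exact: Ppr.
Qed.

End QuotientIdeals.

(** * Supports of monomials and ideals generated by variables *)

Section MonomialSupport.
Variables (K : fieldType) (s : nat).
Implicit Types (m : 'X_{1..s}) (p q : {mpoly K[s]}) (W A : {set 'I_s}).

Definition mnm_support m : {set 'I_s} := [set i | m i != 0%N].

Definition mnm_of_set A : 'X_{1..s} := [multinom (i \in A : nat) | i < s].

Lemma mnm_supportD m1 m2 :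
  mnm_support (m1 + m2)%MM = mnm_support m1 :|: mnm_support m2.
Proof. by apply/setP=> i; rewrite !inE mnmDE addn_eq0 negb_and. Qed.

Lemma mnm_support_of_set A : mnm_support (mnm_of_set A) = A.
Proof. by apply/setP=> i; rewrite !inE mnmE; case: (i \in A). Qed.

Lemma mdeg_mnm_of_set A : mdeg (mnm_of_set A) = #|A|.
Proof.
rewrite mdegE -sum1_card [RHS]big_mkcond /=.
by apply: eq_bigr => i _; rewrite mnmE; case: (i \in A).
Qed.

Lemma card_mnm_support m : (#|mnm_support m| <= mdeg m)%N.
Proof.
rewrite mdegE -sum1_card big_mkcond /=; apply: leq_sum => i _.
by rewrite inE; case: (m i).
Qed.

Lemma edge_monomialE A : edge_monomial K A = 'X_[mnm_of_set A].
Proof.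
rewrite /edge_monomial mpolyXE_id [LHS]big_mkcond /=.
by apply: eq_bigr => i _; rewrite mnmE; case: (i \in A).
Qed.

Lemma mpolyX_mem_ideal (P : {pred {mpoly K[s]}}) m i :
  idealr_closed P -> 'X_i \in P -> i \in mnm_support m -> 'X_[m] \in P.
Proof.
move=> Pid XP; rewrite inE -lep1mP => /submK <-.
by rewrite mpolyXD ideal_mull.
Qed.

Lemma mpoly_mem_ideal (P : {pred {mpoly K[s]}}) p :
  idealr_closed P -> {in msupp p, forall m, 'X_[m] \in P} -> p \in P.
Proof.
move=> Pid suppP; rewrite (mpolyE p) ideal_sum // => m /suppP mP.
by rewrite -mul_mpolyC ideal_mull.
Qed.

(* The ideal generated by the variables X_i, i in W. *)
Definition coord_ideal W : {pred {mpoly K[s]}} :=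
  [pred p | all (fun m => ~~ [disjoint W & mnm_support m]) (msupp p)].

Lemma coord_ideal_min (P : {pred {mpoly K[s]}}) W :
  idealr_closed P -> {in W, forall i, 'X_i \in P} ->
  {subset coord_ideal W <= P}.
Proof.
move=> Pid WP p /allP pW; apply: mpoly_mem_ideal => // m /pW.
rewrite disjoint_sym => /pred0Pn[i /andP[im iW]].
by apply: mpolyX_mem_ideal im => //; exact: WP.
Qed.

Lemma mem_coord_idealX W m :
  ('X_[m] \in coord_ideal W) = ~~ [disjoint W & mnm_support m].
Proof. by rewrite inE msuppX /= andbT. Qed.

Lemma mem_coord_idealXU W i : ('X_i \in coord_ideal W) = (i \in W).
Proof.
rewrite mem_coord_idealX; apply/pred0Pn/idP => [[j]|iW].
  by rewrite !inE mnm1E eqb0 negbK => /andP[jW /eqP ->].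
by exists i; rewrite !inE mnm1E eqxx iW.
Qed.

(** Substituting this tuple is a ring endomorphism of a domain with kernel [coord_ideal W], whence
    the primality of that ideal. *)
Definition zero_out W : s.-tuple {mpoly K[s]} :=
  [tuple if i \in W then 0 else 'X_i | i < s].

Lemma zero_outX W m :
  'X_[m] \mPo zero_out W =
  if [disjoint W & mnm_support m] then 'X_[m] else 0.
Proof.
rewrite comp_mpolyX; case: ifPn => [dis|/pred0Pn[i]].
  rewrite mpolyXE_id; apply: eq_bigr => i _; rewrite tnth_mktuple.
  case: ifPn => // iW; have := disjointFr dis iW.
  by rewrite inE => /negbFE/eqP ->; rewrite !expr0.
rewrite !inE => /andP[iW im]; rewrite (bigD1 i) //= tnth_mktuple iW.
by rewrite expr0n (negbTE im) mul0r.
Qed.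

Lemma mcoeff_zero_out W p m :
  (p \mPo zero_out W)@_m = if [disjoint W & mnm_support m] then p@_m else 0.
Proof.
rewrite comp_mpolyEX raddf_sum /= [p in RHS]mpolyE raddf_sum /=.
case: ifPn => [dis|Ndis]; last rewrite big1 // => m' _.
  apply: eq_bigr => m' _; rewrite !mcoeffZ zero_outX; case: ifPn => // Ndis'.
  by rewrite mcoeffX mcoeff0; case: eqP => // e; rewrite e dis in Ndis'.
rewrite mcoeffZ zero_outX; case: ifPn => dis'; last by rewrite mcoeff0 mulr0.
rewrite mcoeffX; case: eqP => [e|_]; last by rewrite mulr0.
by rewrite -e dis' in Ndis.
Qed.

Lemma mem_coord_ideal W p : (p \in coord_ideal W) = (p \mPo zero_out W == 0).
Proof.
apply/allP/eqP => [pW|p0 m].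
  apply/mpolyP=> m; rewrite mcoeff_zero_out mcoeff0.
  case: ifP => // dis; apply: memN_msupp_eq0.
  by apply/negP=> /pW; rewrite dis.
rewrite mcoeff_msupp; apply: contraNN => dis.
by have := mcoeff_zero_out W p m; rewrite dis p0 mcoeff0 => <-.
Qed.

Lemma coord_ideal_prime W : prime_ideal (coord_ideal W).
Proof.
split; first split.
- by rewrite mem_coord_ideal comp_mpoly0.
- by rewrite mem_coord_ideal comp_mpoly1 oner_eq0.
- move=> a u v; rewrite !mem_coord_ideal rmorphD rmorphM /= => /eqP -> /eqP ->.
  by rewrite mulr0 addr0.
- by move=> u v; rewrite !mem_coord_ideal rmorphM /= mulf_eq0.
Qed.

Lemma coord_ideal_sub W W' :
  W \subset W' -> {subset coord_ideal W <= coord_ideal W'}.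
Proof.
move=> /subsetP sWW'; apply: coord_ideal_min.
  by case: (coord_ideal_prime W').
by move=> i iW; rewrite mem_coord_idealXU; exact: sWW'.
Qed.

End MonomialSupport.

Arguments coord_ideal K {s} W.

(** * Length of prime chains by counting monomials *)

Section KrullUpperBound.
Variables (K : fieldType) (s : nat).
Local Notation S := {mpoly K[s]}.
Implicit Types (p q : S) (P : {pred S}) (J : finType).

Definition lin_indep_mod P J (F : J -> S) : Prop :=
  forall c : J -> K, \sum_j c j *: F j \in P -> forall j, c j = 0.

(** Modulo [P'] only the term [F 0] survives, so it vanishes; the rest is [x] times a shorter sum,
    and [x] cancels because [P] is prime. In use, the [F j] lie in a [K]-subspace meeting [P'] only
    in 0. *)
Lemma powers_indep_mod (P P' : {pred S}) (x : S) (N : nat) (F : 'I_N -> S) :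
  prime_ideal P -> prime_ideal P' -> {subset P <= P'} ->
  x \in P' -> x \notin P -> (forall j, F j \in P' -> F j = 0) ->
  \sum_(j < N) x ^+ j * F j \in P -> forall j, F j = 0.
Proof.
move=> [Pid Ppr] [P'id _] sPP' xP' xP.
elim: N F => [|N IHN] F F0 sumP; first by case.
move: sumP; rewrite big_ord_recl expr0 mul1r.
under eq_bigr do rewrite exprS -mulrA.
rewrite -mulr_sumr => sumP.
have F00 : F ord0 = 0.
  by apply/F0/(ideal_addK P'id _ (sPP' _ sumP)); rewrite mulrC ideal_mull.
move: sumP; rewrite F00 add0r => /Ppr; rewrite (negbTE xP) /= => sumP.
have IH := IHN (fun j => F (lift ord0 j)) (fun j => @F0 _) sumP.
by move=> j; case: (unliftP ord0 j) => [j'|] ->.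
Qed.

Definition mdeg_le p (d : nat) : Prop :=
  {in msupp p, forall m, (mdeg m <= d)%N}.

Lemma mdeg_leM p q d e : mdeg_le p d -> mdeg_le q e -> mdeg_le (p * q) (d + e).
Proof.
move=> pd qe m /msuppM_le/allpairsP[[m1 m2] /= [/pd m1d /qe m2e ->]].
by rewrite mdegD leq_add.
Qed.

Lemma mdeg_leX p d n : mdeg_le p d -> mdeg_le (p ^+ n) (n * d).
Proof.
move=> pd; elim: n => [|n IHn]; last by rewrite exprS mulSn; exact: mdeg_leM.
by move=> m; rewrite expr0 msupp1 inE => /eqP ->; rewrite mdeg0.
Qed.

Lemma mdeg_leW p d e : (d <= e)%N -> mdeg_le p d -> mdeg_le p e.
Proof. by move=> de pd m /pd md; exact: leq_trans md de. Qed.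

(** Induction from the top of the chain: a family independent modulo [P 1] is multiplied by the
    powers of [x 0] below [N]. Indexing by [nat] makes the shifted chain [P \o succn] available. *)
Lemma chain_indep_mod (n N D : nat) (P : nat -> {pred S}) (x : nat -> S) :
  (forall i, (i <= n)%N -> prime_ideal (P i)) ->
  (forall i, (i < n)%N ->
    [/\ {subset P i <= P i.+1}, x i \in P i.+1, x i \notin P i
      & mdeg_le (x i) D]) ->
  exists J (F : J -> S),
    [/\ #|J| = (N ^ n)%N, lin_indep_mod (P 0%N) F
      & forall j, mdeg_le (F j) (n * (N * D))].
Proof.
elim: n P x => [|n IHn] P x Ppr Px.
  have [[_ P1 PD] _] := Ppr 0%N isT.
  exists unit, (fun=> 1); split; first by rewrite card_unit.
    move=> c; rewrite (big_pred1 tt) => [cP []|[]//].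
    apply: contraNeq P1 => c0; rewrite -[1](scalerK c0) -mul_mpolyC.
    by rewrite ideal_mull //; case: (Ppr 0%N isT).
  by move=> _ m; rewrite msupp1 inE => /eqP ->; rewrite mdeg0.
have [|i i_n|J [F [cardJ Find Fdeg]]] := IHn (P \o succn) (x \o succn).
- by move=> i i_n; exact: Ppr.
- exact: Px.
have [sP xP' xP xD] := Px 0%N isT.
exists ('I_N * J)%type, (fun ij : 'I_N * J => x 0%N ^+ ij.1 * F ij.2); split.
- by rewrite card_prod card_ord cardJ expnS.
- move=> c.
  have -> : \sum_ij c ij *: (x 0%N ^+ ij.1 * F ij.2) =
            \sum_(i < N) x 0%N ^+ i * \sum_j c (i, j) *: F j.
    under [RHS]eq_bigr do rewrite mulr_sumr.
    rewrite pair_bigA; apply: eq_bigr => -[i j] _ /=; exact: scalerAr.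
  have Gind (i : 'I_N) :
    \sum_j c (i, j) *: F j \in P 1%N -> forall j, c (i, j) = 0 by exact: Find.
  move=> sumP.
  have c0 : forall i : 'I_N, \sum_j c (i, j) *: F j = 0.
    apply: (powers_indep_mod (Ppr 0%N isT) (Ppr 1%N isT) sP xP' xP _ sumP).
    by move=> i /Gind c0; rewrite big1 // => j _; rewrite c0 scale0r.
  (* Each inner sum is 0, an element of [P 1], so independence modulo [P 1] applies again. *)
  by move=> [i j]; apply: (Gind i); rewrite c0; case: (Ppr 1%N isT) => -[].
- move=> [i j]; rewrite mulSn; apply: mdeg_leM; last exact: Fdeg.
  apply: mdeg_leW (mdeg_leX (n := i) xD).
  by rewrite leq_mul2r (ltnW (ltn_ord i)) orbT.
Qed.

Lemma card_indep_mod P J (F : J -> S) (W : {set 'I_s}) (d : nat) :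
  idealr_closed P -> {in W, forall i, 'X_i \in P} ->
  lin_indep_mod P F -> (forall j, mdeg_le (F j) d) ->
  (#|J| <= d.+1 ^ #|~: W|)%N.
Proof.
move=> Pid WP Find Fdeg.
(* Exponent vectors vanishing on [W] with every entry at most [d]: they include all those of total
   degree at most [d] and are easy to count. *)
pose T := [set f in pffun_on (@ord0 d) (~: W) predT].
have <- : #|T| = (d.+1 ^ #|~: W|)%N by rewrite cardsE card_pffun_on card_ord.
pose mon (f : {ffun 'I_s -> 'I_d.+1}) := [multinom (f i : nat) | i < s].
pose B := \matrix_(j < #|J|, t < #|T|) (F (enum_val j))@_(mon (enum_val t)).
suff /eqP <- : row_free B by exact: rank_leq_col.
apply/inj_row_free => v vB; apply/rowP => j0; rewrite mxE -[j0]enum_valK.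
apply: (Find (fun j => v 0 (enum_rank j))).
(* A combination whose coefficients on [T] all vanish has only monomials meeting [W], so it lies in
   [P]; thus the rows of [B] are independent. *)
apply: (coord_ideal_min Pid WP); apply/allP=> m; rewrite mcoeff_msupp.
apply: contraNN => dis.
rewrite raddf_sum /=.
have [dm|md] := ltnP d (mdeg m).
  rewrite big1 // => j _; rewrite mcoeffZ memN_msupp_eq0 ?mulr0 //.
  by apply/negP=> /Fdeg; rewrite leqNgt dm.
pose f := [ffun i => inord (m i) : 'I_d.+1].
have mi i : (f i : nat) = m i.
  rewrite ffunE inordK // ltnS; apply: leq_trans md.
  by rewrite mdegE (bigD1 i) //= leq_addr.
have fT : f \in T.
  rewrite inE; apply/pffun_onP; split => //.
  apply/subsetP => i; rewrite !inE -val_eqE /= mi => im.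
  by apply: contraTN im => /(disjointFr dis); rewrite inE => ->.
have <- : mon f = m by apply/mnmP => i; rewrite mnmE mi.
move/rowP: vB => /(_ (enum_rank_in fT f)); rewrite !mxE => vB.
rewrite -[X in _ == X]vB; apply/eqP.
rewrite (reindex _ (onW_bij _ (@enum_val_bij J))) /=.
by apply: eq_bigr => j _; rewrite mcoeffZ !mxE enum_valK enum_rankK_in.
Qed.

Lemma expn_gt_poly (a b n : nat) : (b < n)%N ->
  exists N, ((a * N).+1 ^ b < N ^ n)%N.
Proof.
(* With this [N], the left side is at most [(a.+1 * N) ^ b], and [a.+1 ^ b < N] makes that less than
   [N ^ b.+1]. *)
move=> bn; pose N := (a.+1 ^ b).+1; exists N.
apply: (@leq_trans (N ^ b.+1)); last by rewrite leq_exp2l // ltnS expn_gt0.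
apply: (@leq_ltn_trans ((a.+1 * N) ^ b)).
  case: (posnP b) => [->//|b0]; rewrite leq_exp2r //.
  by rewrite mulSn -addn1 addnC leq_add2r.
by rewrite expnMn expnS ltn_pmul2r // expn_gt0.
Qed.

Lemma chain_length_le (n : nat) (P : nat -> {pred S}) (W : {set 'I_s}) :
  (forall i, (i <= n)%N -> prime_ideal (P i)) ->
  (forall i, (i < n)%N ->
    {subset P i <= P i.+1} /\ ~ {subset P i.+1 <= P i}) ->
  {in W, forall i, 'X_i \in P 0%N} ->
  (n <= #|~: W|)%N.
Proof.
move=> Ppr Pchain WP; rewrite leqNgt; apply/negP => Wn.
(* Keeping [i < n] under the existential makes [x] total, with arbitrary values beyond the chain. *)
have /choice[x xP] :
    forall i, exists y, (i < n)%N -> y \in P i.+1 /\ y \notin P i.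
  move=> i; case: (ltnP i n) => i_n; last by exists 0.
  have [_ /existsNP[y /not_implyP[yP' yP]]] := Pchain i i_n.
  by exists y => _; split => //; apply/negP.
pose D := \max_(i < n) msize (x i).
have [N] := expn_gt_poly (n * D) Wn; apply/negP; rewrite -leqNgt.
have [//|i i_n|J [F [<- Find Fdeg]]] := @chain_indep_mod n N D P x.
  have [xP' xPN] := xP i i_n; have [sP _] := Pchain i i_n; split => //.
  move=> m /msize_mdeg_lt/ltnW/leq_trans; apply.
  exact: (leq_bigmax (Ordinal i_n)).
rewrite -mulnA [(D * N)%N]mulnC.
by apply: card_indep_mod Find Fdeg => //; case: (Ppr 0%N isT).
Qed.

End KrullUpperBound.

(** * Stable sets, neighbourhoods and vertex covers *)

Section CoverCombinatorics.
Variables (s : nat) (C : clutter s).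
Implicit Types (A B W : {set 'I_s}).

Lemma stablePn A :
  reflect (exists2 e, e \in edges C & e \subset A) (~~ stable C A).
Proof.
apply: (iffP idP) => [/forall_inPn[e eC /negPn eA]|[e eC eA]].
  by exists e.
by apply/forall_inPn; exists e => //; apply/negPn.
Qed.

Lemma in_nbhd A i : (i \in nbhd C A) = ~~ stable C (i |: A).
Proof.
rewrite inE; apply/exists_inP/stablePn => -[e eC eA]; by exists e.
Qed.

Lemma vertex_coverS A B : A \subset B -> vertex_cover C A -> vertex_cover C B.
Proof.
move=> AB /forall_inP Acov; apply/forall_inP=> e /Acov/set0Pn[i].
rewrite inE => /andP[ie iA]; apply/set0Pn; exists i.
by rewrite inE ie (subsetP AB).
Qed.

Lemma stable_setC A : stable C A = vertex_cover C (~: A).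
Proof.
apply: eq_forallb => e; congr (_ ==> _).
by rewrite -setDE setD_eq0.
Qed.

Lemma nbhd_disjoint A : stable C A -> [disjoint nbhd C A & A].
Proof.
move=> Ast; apply/pred0P => i /=; apply/negP => /andP[].
rewrite in_nbhd => /negP iAst iA; apply: iAst.
by rewrite (setUidPr _) ?sub1set.
Qed.

(** Each [i] in [nbhd C A] has an edge inside [i |: A]; as [A] misses the neighbourhood, a smaller
    cover can meet that edge only at [i]. *)
Lemma nbhd_cover_minimal A :
  stable C A -> minimal_vertex_cover C (nbhd C A) = vertex_cover C (nbhd C A).
Proof.
move=> Ast; apply/minsetP/idP => [[]//|cov]; split=> // B Bcov BN.
apply/eqP; rewrite eqEsubset BN; apply/subsetP => i iN.
move: (iN); rewrite in_nbhd => /stablePn[e eC eA].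
have /set0Pn[j] := forall_inP Bcov e eC.
rewrite inE => /andP[/(subsetP eA)]; rewrite !inE => /orP[/eqP->//|jA] jB.
by have := disjointFl (nbhd_disjoint Ast) jA; rewrite (subsetP BN).
Qed.

Lemma in_family_A A :
  (A \in family_A C) = stable C A && vertex_cover C (nbhd C A).
Proof.
by rewrite inE; case: (boolP (stable C A)) => //= /nbhd_cover_minimal ->.
Qed.

(** By maximality, adding any vertex outside [A] creates an edge, so the neighbourhood contains the
    cover [~: A]. *)
Lemma family_F_sub_A : family_F C \subset family_A C.
Proof.
apply/subsetP => A; rewrite inE in_family_A => /maxsetP[Ast Amax].
rewrite Ast; apply: (@vertex_coverS (~: A)); last by rewrite -stable_setC.
apply/subsetP => i; rewrite inE in_nbhd; apply: contraNN => /Amax <-.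
  exact: setU11.
exact: subsetUr.
Qed.

Lemma maximum_stable_maximal A : maximum_stable C A -> maximal_stable C A.
Proof.
case/andP => Ast /forall_inP Amax; apply/maxsetP; split=> // B Bst AB.
by apply/eqP; rewrite eq_sym eqEcard AB Amax.
Qed.

Lemma maximum_stable_exists : exists A, maximum_stable C A.
Proof.
have st0 : stable C set0.
  apply/forall_inP => e eC; rewrite subset0.
  by apply: contraTneq eC => ->; exact: edges_nonempty.
exists [arg max_(A > set0 | stable C A) #|A|].
case: arg_maxnP => // A Ast Amax.
by rewrite /maximum_stable Ast; apply/forall_inP.
Qed.

End CoverCombinatorics.

(** * Colon ideals, v-number and dimension for the edge ideal *)

Section EdgeIdealAlgebra.
Variables (K : fieldType) (s : nat) (C : clutter s).
Local Notation S := {mpoly K[s]}.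
Local Notation I := (edge_ideal K C).
Implicit Types (m : 'X_{1..s}) (A W : {set 'I_s}).

Lemma edge_monomial_mem (e : {set 'I_s}) :
  e \in edges C -> edge_monomial K e \in I.
Proof.
move=> eC; apply/asboolP; exists (fun f => (f == e)%:R).
rewrite (bigD1 e) //= eqxx mul1r big1 ?addr0 // => f /andP[_ /negbTE ->].
by rewrite mul0r.
Qed.

(** Membership in a monomial ideal is tested on monomials, and a squarefree generator divides a
    monomial exactly when its edge lies in the support. *)
Lemma mem_edge_ideal (p : S) :
  (p \in I) = all (fun m => ~~ stable C (mnm_support m)) (msupp p).
Proof.
apply/idP/allP => [/asboolP[c ->] m|pst].
  move=> /msupp_sum_le /flattenP[r /mapP[e]].
  rewrite mem_filter => /andP[eC _] -> /msuppM_le/allpairsP[[m1 m2] /= [_]].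
  rewrite edge_monomialE msuppX inE => /eqP -> ->.
  apply/stablePn; exists e => //.
  by rewrite mnm_supportD mnm_support_of_set subsetUr.
apply: (mpoly_mem_ideal (edge_ideal_idealr_closed K C)).
move=> m /pst /stablePn[e eC em].
have /submK <- : (mnm_of_set e <= m)%MM.
  apply/mnm_lepP => i; rewrite mnmE.
  case: (boolP (i \in e)) => // /(subsetP em).
  by rewrite inE lt0n.
by rewrite mpolyXD -edge_monomialE ideal_mull ?edge_monomial_mem //;
  exact: edge_ideal_idealr_closed.
Qed.

Lemma prime_ideal_cover (P : {pred S}) :
  prime_ideal P -> {subset I <= P} ->
  vertex_cover C [set i | 'X_i \in P].
Proof.
move=> [Pid Ppr] IP; apply/forall_inP => e /edge_monomial_mem/IP.
move=> /(prime_ideal_prod Pid Ppr)[i ie iP].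
by apply/set0Pn; exists i; rewrite !inE ie.
Qed.

Lemma edge_ideal_sub_coord W :
  vertex_cover C W -> {subset I <= coord_ideal K W}.
Proof.
move=> /forall_inP Wcov p; rewrite mem_edge_ideal => /allP pst.
apply/allP => m /pst /stablePn[e /Wcov/set0Pn[i]].
rewrite inE => /andP[ie iW] /subsetP em.
by apply/pred0Pn; exists i; rewrite /= iW em.
Qed.

(** An edge inside the union of [A] and the support of a monomial meets the cover [nbhd C A],
    necessarily off [A], so at a variable of the monomial. *)
Lemma colon_edge_ideal A (g : S) :
  A \in family_A C ->
  (g * 'X_[mnm_of_set A] \in I) = (g \in coord_ideal K (nbhd C A)).
Proof.
rewrite in_family_A => /andP[Ast Acov].
rewrite mem_edge_ideal (perm_all _ (msuppMX _ _)) all_map.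
apply: eq_all => m /=; rewrite mnm_supportD mnm_support_of_set.
apply/stablePn/pred0Pn => [[e eC eAm]|[i /= /andP[iN im]]].
  have /set0Pn[i] := forall_inP Acov e eC; rewrite inE => /andP[ie iN].
  exists i; rewrite /= iN /=; have := subsetP eAm i ie.
  by rewrite in_setU (disjointFr (nbhd_disjoint Ast) iN).
move: iN; rewrite in_nbhd => /stablePn[e eC eA]; exists e => //.
by apply: subset_trans eA _; rewrite setUC setUS // sub1set.
Qed.

Lemma v_degree_card A : A \in family_A C -> v_degree I #|A|.
Proof.
move=> AA; exists 'X_[mnm_of_set A], (coord_ideal K (nbhd C A)); split.
- by rewrite dhomogX; apply/eqP; exact: mdeg_mnm_of_set.
- split; first exact: coord_ideal_prime.
  exists (\pi 'X_[mnm_of_set A]) => a.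
  by rewrite -rmorphM ideal_quot_pi_eq0 colon_edge_ideal.
- by move=> g; rewrite inE colon_edge_ideal.
Qed.

(* If t^m is a monomial of f outside I, then t_i in (I : f) forces t_i t^m in I,
   hence i in N(supp m); so N(supp m) contains the cover formed by the variables
   of the prime (I : f). *)
Lemma v_degree_family_A (d : nat) :
  v_degree I d -> exists2 A, A \in family_A C & (#|A| <= d)%N.
Proof.
move=> [f [p [fhom [[pid ppr] _] colon]]].
have mem_p g : (g \in p) = (g * f \in I) by rewrite -colon.
have : f \notin I by case: (pid) => _ + _; rewrite mem_p mul1r.
rewrite mem_edge_ideal => /allPn[m mf /negPn mst].
exists (mnm_support m); last first.
  by rewrite -(dhomog_mf fhom mf) card_mnm_support.
rewrite in_family_A mst /=.
apply: vertex_coverS (prime_ideal_cover (conj pid ppr) _) => [|g gI]; last first.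
  by rewrite mem_p mulrC ideal_mull //; exact: edge_ideal_idealr_closed.
apply/subsetP => i; rewrite inE mem_p in_nbhd mulrC mem_edge_ideal.
move=> /allP/(_ (U_(i) + m)%MM); rewrite (perm_mem (msuppMX _ _)) map_f //.
move=> /(_ isT); rewrite mnm_supportD; congr (~~ stable _ (_ :|: _)).
by apply/setP => j; rewrite !inE mnm1E eqb0 negbK eq_sym.
Qed.

Lemma krull_dim_edge_ideal A :
  maximum_stable C A -> is_krull_dim {ideal_quot I} #|A|.
Proof.
case/andP => Ast /forall_inP Amax; split.
  (* Chain of length [#|A|]: start from the variables outside [A] and add those of [A] one at a
     time. *)
  pose W (k : nat) := ~: A :|: [set i in take k (enum A)].
  have Wcov k : vertex_cover C (W k).
    by apply: vertex_coverS (subsetUl _ _) _; rewrite -stable_setC.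
  pose P (k : 'I_#|A|.+1) : {pred {ideal_quot I}} :=
    [pred x | repr x \in coord_ideal K (W k)].
  exists P; split=> [k|k l kl].
    apply: prime_ideal_quot; first exact: coord_ideal_prime.
    exact: edge_ideal_sub_coord.
  split=> [x|sub].
    apply: coord_ideal_sub; apply: setUS; apply/subsetP => i; rewrite !inE.
    by rewrite -(subnKC (ltnW kl)) takeD mem_cat => ->.
  have kA : (k < size (enum A))%N by rewrite -cardE (leq_trans kl) // -ltnS.
  have [x0 _] : exists x0, x0 \in A.
    by apply/card_gt0P; rewrite cardE (leq_ltn_trans _ kA).
  (* The variable of index [k] in [A] enters [W] at stage [k.+1], so it separates stages [k] and
     [l]. *)
  pose i := nth x0 (enum A) k.
  have iA : i \in A by rewrite -mem_enum mem_nth.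
  have mem_P (j : 'I_#|A|.+1) : (\pi 'X_i \in P j) = (i \in W j).
    rewrite inE (mem_repr_pi _ _ (edge_ideal_sub_coord (Wcov j))).
      by rewrite mem_coord_idealXU.
    by case: (coord_ideal_prime K (W j)).
  have mem_W (j : 'I_#|A|.+1) : (i \in W j) = (k < j)%N.
    have jA : (j <= size (enum A))%N by rewrite -cardE -ltnS.
    by rewrite !inE iA in_take_leq // index_uniq ?enum_uniq.
  have := sub (\pi 'X_i); rewrite !mem_P !mem_W kl ltnn.
  by move/(_ isT).
move=> n P [Ppr Pchain].
(* The chain is pulled back to [S] and extended to [nat]; values of [inord] beyond [n] are never
   inspected. *)
pose Q (k : nat) : {pred S} := [pred a | \pi_{ideal_quot I} a \in P (inord k)].
have Qpr k : prime_ideal (Q k) by exact: prime_ideal_preim.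
have IQ k : {subset I <= Q k}.
  move=> a; rewrite -ideal_quot_pi_eq0 => /eqP a0; rewrite inE a0.
  by case: (Ppr (inord k)) => -[].
have Qcov := prime_ideal_cover (Qpr 0%N) (IQ 0%N).
apply: (@leq_trans #|~: [set i | 'X_i \in Q 0%N]|).
  apply: (@chain_length_le K s n Q) => // [k kn|i]; last by rewrite inE.
  have [|sub nsub] := Pchain (inord k) (inord k.+1).
    by rewrite !inordK // ltnW.
  split=> [a|sub']; first exact: sub.
  by apply: nsub => x; rewrite -[x]reprK; exact: sub'.
by apply: Amax; rewrite stable_setC setCK.
Qed.

End EdgeIdealAlgebra.

(** * Comparing the v-number with the dimension *)

Lemma is_krull_dim_uniq (R : comNzRingType) (d d' : nat) :
  is_krull_dim R d -> is_krull_dim R d' -> d = d'.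
Proof.
move=> [[P Pchain] Rd] [[P' P'chain] Rd']; apply/eqP.
by rewrite eqn_leq (Rd' _ _ Pchain) (Rd _ _ P'chain).
Qed.

Theorem corollary3p7 (K : fieldType) (s : nat) (hs : (1 <= s)%N)
    (C : clutter s) :
  (exists d : nat,
     is_v_number (edge_ideal K C) d /\
     is_krull_dim {ideal_quot (edge_ideal K C)} d)
  <->
  (well_covered C /\ family_F C = family_A C).
Proof.
have [M Mmax] := maximum_stable_exists C.
have dimM := krull_dim_edge_ideal K Mmax.
have /andP[Mst /forall_inP le_M] := Mmax.
split=> [[d [[_ vmin] dimd]]|[wc FA]].
  (* Here [#|A|] is at least the v-number, which equals the dimension [#|M|]. *)
  have A_maximum A : A \in family_A C -> maximum_stable C A.
    move=> AA; have := AA; rewrite in_family_A => /andP[Ast _].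
    rewrite /maximum_stable Ast; apply/forall_inP => B /le_M/leq_trans; apply.
    by rewrite (is_krull_dim_uniq dimM dimd); exact/vmin/v_degree_card.
  split=> [A Amax|].
    by apply/A_maximum/(subsetP (family_F_sub_A C)); rewrite inE.
  apply/eqP; rewrite eqEsubset family_F_sub_A; apply/subsetP => A /A_maximum.
  by rewrite inE; exact: maximum_stable_maximal.
(* [M] attains this degree; any other degree bounds the size of a set in [family_A C], which is
   maximal stable and hence as large as [M]. *)
exists #|M|; split=> //; split=> [|d /v_degree_family_A[A]].
  by apply: v_degree_card; rewrite -FA inE maximum_stable_maximal.
rewrite -FA inE => /wc/andP[_ /forall_inP le_A]; apply: leq_trans.
exact: le_A.
Qed.
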